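(* Let $A=\mathbb{R}_{\bot,\log_2,f}$ be the expansion of $\mathbb{R}_{\bot,\log_2}$ with the unary function $f$ defined by $f(x)=\mathsf{s}^2(x)$, the square of the sign function. Then $A$ allows term expressions to define cross-entropy for sample spaces of all finite sizes $n$.
   Context: The algebra $\mathbb{R}_{\bot,\log_2}$ has domain $\mathbb{R}\cup\{\bot\}$ with $\bot\notin\mathbb{R}$, constants $0,1,\bot$, and total operations $x+y$, $-x$, $x\cdot y$, $\frac{x}{y}$, $\log_2(x)$. On real arguments these are the usual operations, except that $\frac{x}{0}=\bot$ for all $x$, and $\log_2(x)=\bot$ for real $x\le 0$. Each operation returns $\bot$ whenever one of its arguments is $\bot$. $\mathbb{R}_{\bot,\log_2,f}$ is the expansion by the additional operation $f$. The sign function is $\mathsf{s}(0)=0$, $\mathsf{s}(x)=1$ for real $x>0$, $\mathsf{s}(x)=-1$ for real $x<0$, $\mathsf{s}(\bot)=\bot$; and $\mathsf{s}^2(x)=\mathsf{s}(x)\cdot\mathsf{s}(x)$. A probability mass function on a finite set $V$ is a function $P:V\to\mathbb{R}$ with $P(x)\ge 0$ for all $x\in V$ and $\sum_{x\in V}P(x)=1$. Left-sequential multiplication on $\mathbb{R}\cup\{\bot\}$: $x\ltimes y = 0$ if $x=0$ (also when $y=\bot$), and $x\ltimes y = x\cdot y$ if $x\neq 0$. Cross-entropy is $H^V_\bot(P,Q) = -\sum_{x\in V}P(x)\ltimes\log_2 Q(x)$ (so it is $\bot$ if some $x\in V$ has $P(x)\ne0$ and $Q(x)=0$). Let $A$ be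 an algebra on $\mathbb{R}\cup\{\bot\}$ with signature $\Sigma$. $A$ allows term expressions for cross-entropy for sample spaces of size $n$ if, for new constants $c_1,\dots,c_n$, there is a closed expression $\phi^n_H(\alpha,\beta)$ over $\Sigma\cup\{c_1,\dots,c_n\}$ and unary function variables $\alpha,\beta$, such that for every $V\subseteq\mathbb{R}$ with $|V|=n$, every interpretation of $c_1,\dots,c_n$ as an enumeration of $V$ without repetitions, and every pair of probability mass functions $P,Q$ on $V$, $H^V_\bot(P,Q)=[P/\alpha,Q/\beta]\phi^n_H(\alpha,\beta)$ (the value in $A$ of the expression with $\alpha,\beta$ interpreted as $P,Q$). Since $P,Q$ are defined only on $V$, it is required that in all these evaluations $\alpha$ and $\beta$ are applied only to arguments whose value lies in $V$. *)

(* Defs.v *)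
From HB Require Import structures.
From mathcomp Require Import all_boot all_order all_algebra.
From mathcomp Require Import finmap.
From mathcomp Require Import boolp reals exp.

Set Implicit Arguments.
Unset Strict Implicit.
Unset Printing Implicit Defensive.

Import Order.TTheory GRing.Theory Num.Theory.
Local Open Scope ring_scope.

Record signature := Signature { sym : Type; arity : sym -> nat }.

Definition algebra (S : signature) (D : Type) :=
  forall o : sym S, ('I_(arity o) -> D) -> D.

(* The additional unary operation symbol is [None]. *)
Definition expand_sig (S : signature) : signature :=
  @Signature (option (sym S)) (fun o => if o is Some o' then arity o' else 1%N).

Definition expand (S : signature) (D : Type) (A : algebra S D) (f : D -> D) :
    algebra (expand_sig S) D :=
  fun o => match o return ('I_(@arity (expand_sig S) o) -> D) -> D with
           | Some o' => @A o'
           | None => fun a => f (a ord0)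
           end.

(* [option R] is the real numbers extended with one element, bottom = [None]. *)
Section Operations.
Variable R : realType.
Implicit Types x y : option R.

Definition badd x y : option R :=
  if x is Some a then if y is Some b then Some (a + b) else None else None.

Definition bopp x : option R := if x is Some a then Some (- a) else None.

Definition bmul x y : option R :=
  if x is Some a then if y is Some b then Some (a * b) else None else None.

Definition bdiv x y : option R :=
  if x is Some a then
    if y is Some b then if b == 0 then None else Some (a / b) else None
  else None.

Definition blog2 x : option R :=
  if x is Some a then if 0 < a then Some (ln a / ln 2) else None else None.

Definition bsg x : option R := if x is Some a then Some (Num.sg a) else None.

Definition bsg2 x : option R := bmul (bsg x) (bsg x).

Definition lsmul x y : option R := if x == Some 0 then Some 0 else bmul x y.

Lemma baddA : associative badd.
Proof. by move=> [a|] [b|] [c|] //=; rewrite addrA. Qed.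

Lemma baddC : commutative badd.
Proof. by move=> [a|] [b|] //=; rewrite addrC. Qed.

Lemma badd0 : left_id (Some 0) badd.
Proof. by move=> [a|] //=; rewrite add0r. Qed.

HB.instance Definition _ :=
  Monoid.isComLaw.Build (option R) (Some 0) badd baddA baddC badd0.

End Operations.

Inductive log_sym : Type :=
  sym_zero | sym_one | sym_bot | sym_add | sym_opp | sym_mul | sym_div
| sym_log2.

Definition log_sig : signature :=
  Signature (fun o : log_sym => match o with
    | sym_zero | sym_one | sym_bot => 0%N
    | sym_opp | sym_log2 => 1%N
    | sym_add | sym_mul | sym_div => 2%N
    end).

Definition log_algebra (R : realType) : algebra log_sig (option R) :=
  fun o => match o return ('I_(@arity log_sig o) -> option R) -> option R with
    | sym_zero => fun _ => Some 0
    | sym_one => fun _ => Some 1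
    | sym_bot => fun _ => None
    | sym_add => fun a => badd (a ord0) (a ord_max)
    | sym_opp => fun a => bopp (a ord0)
    | sym_mul => fun a => bmul (a ord0) (a ord_max)
    | sym_div => fun a => bdiv (a ord0) (a ord_max)
    | sym_log2 => fun a => blog2 (a ord0)
    end.

(* Closed expressions over S, the constants c_i ([ECst i]) and the unary
   function variables alpha and beta. *)
Inductive expr (S : signature) (n : nat) : Type :=
| EOp (o : sym S) (args : 'I_(arity o) -> expr S n)
| ECst (i : 'I_n)
| EAlpha (t : expr S n)
| EBeta (t : expr S n).

(* [evaluates A c P Q t v]: every argument to which t applies alpha or beta
   evaluates into V, and t then has value v. As P and Q are functions on V only,
   t has no value at all when such an argument lies outside V. *)
Inductive evaluates (S : signature) (R : realType) (A : algebra S (option R))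
    (n : nat) (V : {fset R}) (c : 'I_n -> V) (P Q : V -> R) :
    expr S n -> option R -> Prop :=
| evOp (o : sym S) (args : 'I_(arity o) -> expr S n)
    (vals : 'I_(arity o) -> option R) :
    (forall i, evaluates A c P Q (args i) (vals i)) ->
    evaluates A c P Q (EOp args) (A o vals)
| evCst (i : 'I_n) : evaluates A c P Q (ECst S i) (Some (val (c i)))
| evAlpha (t : expr S n) (x : V) :
    evaluates A c P Q t (Some (val x)) ->
    evaluates A c P Q (EAlpha t) (Some (P x))
| evBeta (t : expr S n) (x : V) :
    evaluates A c P Q t (Some (val x)) ->
    evaluates A c P Q (EBeta t) (Some (Q x)).

Lemma evaluates_functional (S : signature) (R : realType) (A : algebra S (option R))
    (n : nat) (V : {fset R}) (c : 'I_n -> V) (P Q : V -> R) (t : expr S n)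
    (v w : option R) :
  evaluates A c P Q t v -> evaluates A c P Q t w -> v = w.
Proof.
move=> tv; elim: tv w => {t v}
  [o args vals _ IH | i | t x _ IH | t x _ IH] w tw.
- have [vals' -> argsv] : exists2 vals', w = A o vals' &
      forall i, evaluates A c P Q (args i) (vals' i).
    pose inv (e : expr S n) u : Prop := if e is EOp o args then
      exists2 vals', u = A o vals' &
        forall i, evaluates A c P Q (args i) (vals' i) else True.
    suff : inv (EOp args) w by [].
    by case: _ w / tw => [o' args' vals' ? | // | // | //]; exists vals'.
  by congr (A o _); apply/funext => i; apply: IH.
- by inversion tw.
- by inversion tw as [| | t' y ty |]; have [/val_inj ->] := IH _ ty.
- by inversion tw as [| | | t' y ty]; have [/val_inj ->] := IH _ ty.
Qed.

Definition pmf (R : realType) (V : {fset R}) (P : V -> R) : Prop :=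
  (forall x, 0 <= P x) /\ \sum_(x : V) P x = 1.

Definition cross_entropy (R : realType) (V : {fset R}) (P Q : V -> R) :
    option R :=
  bopp (\big[@badd R/Some 0]_(x : V) lsmul (Some (P x)) (blog2 (Some (Q x)))).

Definition allows_cross_entropy (S : signature) (R : realType)
    (A : algebra S (option R)) (n : nat) : Prop :=
  exists phi : expr S n,
    forall V : {fset R}, #|` V| = n ->
    forall c : 'I_n -> V, bijective c ->
    forall P Q : V -> R, pmf P -> pmf Q ->
    evaluates A c P Q phi (cross_entropy P Q).

(* Main.v *)
Require Import Defs.
From mathcomp Require Import all_boot all_order all_algebra reals.
From mathcomp Require Import finmap.

(** The square of the sign turns left-sequential multiplication into a term:
      [p ltimes log2 q = p * log2 (q * s2 p + (1 - s2 p))]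
    for all real [p] and [q], since the logarithm is taken of [1] when [p = 0]
    and of [q] otherwise. *)

Set Implicit Arguments.
Unset Strict Implicit.
Unset Printing Implicit Defensive.

Import GRing.Theory Num.Theory.
Local Open Scope ring_scope.

Lemma lsmul_blog2 (R : realType) (p q : R) :
  let s := bsg2 (Some p) in
  lsmul (Some p) (blog2 (Some q)) =
  bmul (Some p) (blog2 (badd (bmul (Some q) s) (badd (Some 1) (bopp s)))).
Proof.
rewrite /lsmul (inj_eq Some_inj) /=.
have [->|p_neq0] := eqVneq p 0.
  (* The logarithm of [1] is a real number, which the factor [0] annihilates; bottom would survive
     it. *)
  by rewrite sgr0 !mulr0 subr0 add0r ltr01 mul0r.
by rewrite -expr2 sqr_sg p_neq0 mulr1 subrr addr0.
Qed.

(* A unary operation [o] is applied to [t], and [u] is ignored. *)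
Definition op_expr (S : signature) n (o : sym S) (t u : expr S n) : expr S n :=
  EOp (fun i : 'I_(arity o) => if val i == 0%N then t else u).

(** For a concrete [o] the resulting value computes to the operation on [x] and [y], as [ord0] and
    [ord_max] have values 0 and 1 in ['I_2]; chains of this lemma thus match their goals by
    conversion. *)
Lemma evaluates_op (S : signature) (R : realType) (A : algebra S (option R)) n
    (V : {fset R}) (c : 'I_n -> V) (P Q : V -> R) (o : sym S) (t u : expr S n)
    (x y : option R) :
  evaluates A c P Q t x -> evaluates A c P Q u y ->
  evaluates A c P Q (op_expr o t u)
    (A o (fun i => if val i == 0%N then x else y)).
Proof. by move=> tx uy; apply: evOp => i; case: ifP. Qed.

Local Notation sg2_expr n := (expr (expand_sig log_sig) n).
Local Notation sg2_algebra R := (expand (@log_algebra R) (@bsg2 R)).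
Local Notation log_op o := (Some o : sym (expand_sig log_sig)).
Local Notation sg2_op := (None : sym (expand_sig log_sig)).

Definition zero_expr n : sg2_expr n :=
  @EOp _ n (log_op sym_zero)
    (fun i => False_rect _ (notF (ltn_ord i))).

Definition one_expr n : sg2_expr n :=
  @EOp _ n (log_op sym_one)
    (fun i => False_rect _ (notF (ltn_ord i))).

(** The function variables meet only the constant [c_i], so their arguments always lie in [V]. *)
Definition summand_expr n (i : 'I_n) : sg2_expr n :=
  let p := EAlpha (ECst _ i) in
  let q := EBeta (ECst _ i) in
  let s := op_expr sg2_op p p in
  let log_arg := op_expr (log_op sym_add) (op_expr (log_op sym_mul) q s)
    (op_expr (log_op sym_add) (one_expr n) (op_expr (log_op sym_opp) s s)) in
  op_expr (log_op sym_mul) p (op_expr (log_op sym_log2) log_arg log_arg).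

Definition cross_entropy_expr n : sg2_expr n :=
  let sum := foldr (fun i => op_expr (log_op sym_add) (summand_expr i))
    (zero_expr n) (index_enum 'I_n) in
  op_expr (log_op sym_opp) sum sum.

Lemma evaluates_summand (R : realType) n (V : {fset R}) (c : 'I_n -> V)
    (P Q : V -> R) (i : 'I_n) :
  evaluates (sg2_algebra R) c P Q (summand_expr i)
    (lsmul (Some (P (c i))) (blog2 (Some (Q (c i))))).
Proof.
have p_val := evAlpha (evCst (sg2_algebra R) c P Q i).
have q_val := evBeta (evCst (sg2_algebra R) c P Q i).
have s_val := evaluates_op sg2_op p_val p_val.
have one_val : evaluates (sg2_algebra R) c P Q (one_expr n) (Some 1).
  (* Any family of values serves here, since ['I_0] is empty. *)
  by apply: (@evOp _ _ (sg2_algebra R) _ _ _ _ _ (log_op sym_one) _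
    (fun _ => None)) => -[].
have arg_val := evaluates_op (log_op sym_add)
  (evaluates_op (log_op sym_mul) q_val s_val)
  (evaluates_op (log_op sym_add) one_val
    (evaluates_op (log_op sym_opp) s_val s_val)).
rewrite lsmul_blog2.
exact: (evaluates_op (log_op sym_mul) p_val
  (evaluates_op (log_op sym_log2) arg_val arg_val)).
Qed.

Theorem proposition5p4 (R : realType) (n : nat) :
  allows_cross_entropy (expand (@log_algebra R) (@bsg2 R)) n.
Proof.
exists (cross_entropy_expr n) => V _ c c_bij P Q _ _.
(* Reindexing works even with bottom among the summands, as [badd] is a commutative monoid law on
   all of [option R]. *)
rewrite /cross_entropy (reindex c) /=; last exact: onW_bij.
rewrite /cross_entropy_expr.
set e := foldr _ _ _; set v := \big[_/_]_(_ < _) _.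
have ev : evaluates (sg2_algebra R) c P Q e v.
  (* Term and sum fold over the same enumeration of ['I_n], so one induction on that list treats
     both. *)
  rewrite /e /v; elim: (index_enum _) => [|i r IH] /=.
    rewrite big_nil.
    by apply: (@evOp _ _ (sg2_algebra R) _ _ _ _ _ (log_op sym_zero) _
      (fun _ => None)) => -[].
  rewrite big_cons.
  exact: (evaluates_op (log_op sym_add) (evaluates_summand c P Q i) IH).
exact: (evaluates_op (log_op sym_opp) ev ev).
Qed.
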